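(* Let $\mathcal{M}$ denote the class of metrizable balleans and $\mathcal{L}$ the class of ordinal balleans. The following statements hold: (1) every ordinal ballean is $\lambda$-strong; (2) the classes $\mathcal{M}$ and $\mathcal{L}$ are $\lambda$-rigid; (3) an ordinal ballean $(X,\mathcal{E})$ is $\lambda$-rigid if and only if $(X,\mathcal{E})$ is discrete; (4) the classes $\mathcal{M}$ and $\mathcal{L}$ are not $\lambda$-stable.
   Context: A coarse structure on a set $X$ is a family $\mathcal{E}$ of subsets of $X\times X$ such that: each $E\in\mathcal{E}$ contains the diagonal $\triangle_X=\{(x,x):x\in X\}$; if $E,E'\in\mathcal{E}$ then $E\circ E'\in\mathcal{E}$ and $E^{-1}\in\mathcal{E}$, where $E\circ E'=\{(x,y):\exists z\,((x,z)\in E,\ (z,y)\in E')\}$ and $E^{-1}=\{(y,x):(x,y)\in E\}$; if $E\in\mathcal{E}$ and $\triangle_X\subseteq E'\subseteq E$ then $E'\in\mathcal{E}$; and $\bigcup\mathcal{E}=X\times X$. The pair $(X,\mathcal{E})$ is called a ballean (or coarse space). A subfamily $\mathcal{E}'\subseteq\mathcal{E}$ is a base for $\mathcal{E}$ if every $E\in\mathcal{E}$ is contained in some $E'\in\mathcal{E}'$. For $E\in\mathcal{E}$, $x\in X$, $A\subseteq X$: $E[x]=\{y\in X:(x,y)\in E\}$ and $E[A]=\bigcup_{a\in A}E[a]$. A subset $B\subseteq X$ is bounded if $B\subseteq E[x]$ for some $E\in\mathcal{E}$, $x\in X$; otherwise it is unbounded. Subsets $A,B$ of $X$ are close if there is $E\in\mathcal{E}$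 with $A\subseteq E[B]$ and $B\subseteq E[A]$. They are linked, written $A\,\lambda_{(X,\mathcal{E})}\,B$, if either both $A,B$ are bounded or there exist unbounded subsets $A'\subseteq A$, $B'\subseteq B$ that are close. Balleans $(X,\mathcal{E})$, $(X,\mathcal{E}')$ on the same set are $\lambda$-equivalent if $\lambda_{(X,\mathcal{E})}=\lambda_{(X,\mathcal{E}')}$. A ballean $(X,\mathcal{E})$ is: - discrete if for every $E\in\mathcal{E}$ there is a bounded subset $B$ such that $E[x]=\{x\}$ for each $x\in X\setminus B$; - ordinal if $\mathcal{E}$ has a base linearly ordered by inclusion; - metrizable if there is a metric $d$ on $X$ such that $\{\{(x,y):d(x,y)<r\}:r\in\mathbb{R}^+\}$ is a base for $\mathcal{E}$; - $\lambda$-rigid if every coarse structure $\mathcal{E}'$ on $X$ with $\lambda_{(X,\mathcal{E})}=\lambda_{(X,\mathcal{E}')}$ equals $\mathcal{E}$; - $\lambda$-strong if $\mathcal{E}=\mathcal{E}_\lambda$, where $\mathcal{E}_\lambda$ is the largest (by inclusion) coarse structure on $X$ such that $(X,\mathcal{E})$, $(X,\mathcal{E}_\lambda)$ are $\lambda$-equivalent; i.e. every coarse structure $\mathcal{E}'$ on $X$ with $\lambda_{(X,\mathcal{E}')}=\lambda_{(X,\mathcal{E})}$ satisfies $\mathcal{E}'\subseteq\mathcal{E}$. A class $\mathcal{K}$ of balleans is $\lambda$-stable if for any two $\lambda$-equivalent balleans $(X,\mathcal{E})$, $(X,\mathcal{E}')$, $(X,\mathcal{E})\in\mathcal{K}$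 implies $(X,\mathcal{E}')\in\mathcal{K}$; it is $\lambda$-rigid if any two $\lambda$-equivalent balleans $(X,\mathcal{E}),(X,\mathcal{E}')\in\mathcal{K}$ satisfy $\mathcal{E}=\mathcal{E}'$. *)

(* Defs.v *)
(* MathComp / MathComp-Analysis. *)
From mathcomp Require Import all_boot all_order all_algebra.
From mathcomp Require Import boolp classical_sets reals.

Set Implicit Arguments.
Unset Strict Implicit.
Unset Printing Implicit Defensive.

Import Order.TTheory GRing.Theory Num.Theory.

Local Open Scope classical_set_scope.
Local Open Scope ring_scope.
Local Open Scope relation_scope.

(* In [relation_scope], [E' \; E] is the set of the [(x, y)] such that
   [E (x, z)] and [E' (z, y)] for some [z], i.e. the usual E o E'. *)
Record is_coarse_structure (X : Type) (EE : set (set (X * X))) : Prop := {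
  coarse_diag : forall E, EE E -> diagonal `<=` E;
  coarse_comp : forall E E', EE E -> EE E' -> EE (E' \; E);
  coarse_inv : forall E, EE E -> EE (E^-1);
  coarse_sub : forall E E', EE E -> diagonal `<=` E' -> E' `<=` E -> EE E';
  coarse_cover : \bigcup_(E in EE) E = [set: X * X]
}.

Definition is_base (X : Type) (EE BB : set (set (X * X))) : Prop :=
  BB `<=` EE /\ forall E, EE E -> exists2 E', BB E' & E `<=` E'.

Definition setball (X : Type) (E : set (X * X)) (A : set X) : set X :=
  \bigcup_(a in A) xsection E a.

(* When [X] is empty no subset of [X] is bounded, not even [set0]. *)
Definition bounded (X : Type) (EE : set (set (X * X))) (B : set X) : Prop :=
  exists E x, EE E /\ B `<=` xsection E x.

Definition close (X : Type) (EE : set (set (X * X))) (A B : set X) : Prop :=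
  exists E, [/\ EE E, A `<=` setball E B & B `<=` setball E A].

Definition linked (X : Type) (EE : set (set (X * X))) (A B : set X) : Prop :=
  (bounded EE A /\ bounded EE B) \/
  exists A' B', [/\ A' `<=` A, B' `<=` B,
    ~ bounded EE A', ~ bounded EE B' & close EE A' B'].

Definition lambda_equivalent (X : Type) (EE EE' : set (set (X * X))) : Prop :=
  linked EE = linked EE'.

Definition discrete_ballean (X : Type) (EE : set (set (X * X))) : Prop :=
  forall E, EE E ->
    exists2 B, bounded EE B & forall x, ~ B x -> xsection E x = [set x].

Definition ordinal_ballean (X : Type) (EE : set (set (X * X))) : Prop :=
  exists2 BB, is_base EE BB & total_on BB subset.

Record is_metric (R : realType) (X : Type) (d : X -> X -> R) : Prop := {
  metric_ge0 : forall x y, 0 <= d x y;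
  metric_eq0 : forall x y, d x y = 0 <-> x = y;
  metric_sym : forall x y, d x y = d y x;
  metric_triangle : forall x y z, d x z <= d x y + d y z
}.

Definition metrizable_ballean (R : realType) (X : Type)
    (EE : set (set (X * X))) : Prop :=
  exists2 d : X -> X -> R, is_metric d &
    is_base EE [set [set xy | d xy.1 xy.2 < r] | r in [set r | 0 < r]].

Definition lambda_rigid (X : Type) (EE : set (set (X * X))) : Prop :=
  forall EE', is_coarse_structure EE' -> lambda_equivalent EE EE' -> EE' = EE.

(* [EE] belongs to its own lambda-equivalence class, so being the largest
   element [EE_lambda] of that class amounts to being an upper bound of it. *)
Definition lambda_strong (X : Type) (EE : set (set (X * X))) : Prop :=
  forall EE', is_coarse_structure EE' -> lambda_equivalent EE' EE ->
    EE' `<=` EE.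

Definition ballean_class := forall X : Type, set (set (X * X)) -> Prop.

Definition lambda_stable_class (K : ballean_class) : Prop :=
  forall (X : Type) (EE EE' : set (set (X * X))),
    is_coarse_structure EE -> is_coarse_structure EE' ->
    lambda_equivalent EE EE' -> K X EE -> K X EE'.

Definition lambda_rigid_class (K : ballean_class) : Prop :=
  forall (X : Type) (EE EE' : set (set (X * X))),
    is_coarse_structure EE -> is_coarse_structure EE' ->
    lambda_equivalent EE EE' -> K X EE -> K X EE' -> EE = EE'.

(* Main.v *)
Require Import Defs.
From mathcomp Require Import all_boot all_order all_algebra.
From mathcomp Require Import boolp classical_sets reals filter.

(* Linked structures have the same bounded sets.  If EE is ordinal, EE' is
   lambda-equivalent to EE and E' in EE' were not in EE, choose pairs (x, y) of
   E' escaping along a linear base of EE, each far from its own partner and from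
   all the other selected points; then {x} and {y} are linked by E' for EE', but
   they have no unbounded close subsets for EE.  Hence EE' is included in EE,
   which gives the strength and the rigidity of the classes.
     For an ordinal EE that is not discrete, fix an ultrafilter phi containing
   the complements of the bounded sets and the set of points moved by some
   E in EE, and keep only the entourages that are trivial over a member of phi.
   E itself is lost; the linked sets are not, since any unbounded family of
   E-pairs contains two unbounded subfamilies with disjoint supports, and phi
   contains the complement of one of the supports.  The real line is such a
   ballean, and with the rigidity of the classes it refutes their stability. *)

Set Implicit Arguments.
Unset Strict Implicit.
Unset Printing Implicit Defensive.

Local Open Scope classical_set_scope.

(** * Bounded and linked sets of a single coarse structure *)

Section CoarseStructure.
Variables (X : Type) (EE : set (set (X * X))).
Hypothesis HE : is_coarse_structure EE.

Lemma coarse_refl E : EE E -> forall x, E (x, x).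
Proof. by move=> /(coarse_diag HE) dE x; exact: dE. Qed.

Lemma coarse_join E F :
  EE E -> EE F -> exists G, [/\ EE G, E `<=` G & F `<=` G].
Proof.
move=> EE_E EE_F; exists (F \; E)%relation; split; first exact: (coarse_comp HE).
  by move=> [x y] /= Exy; exists y => //; exact: (coarse_refl EE_F).
by move=> [x y] /= Fxy; exists x => //; exact: (coarse_refl EE_E).
Qed.

Lemma coarse_entourage x y : exists2 E, EE E & E (x, y).
Proof.
by have : [set: X * X] (x, y) by []; rewrite -(coarse_cover HE) => -[E]; exists E.
Qed.

Lemma bounded_from x B : bounded EE B -> exists2 E, EE E & forall y, B y -> E (x, y).
Proof.
move=> [E [z [EE_E BE]]]; have [F EE_F Fxz] := coarse_entourage x z.
exists (E \; F)%relation; first exact: (coarse_comp HE).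
by move=> y /BE /xsectionP Ezy; exists z.
Qed.

Lemma bounded_intro E x B : EE E -> (forall y, B y -> E (x, y)) -> bounded EE B.
Proof. by move=> EE_E BE; exists E, x; split=> // y /BE /xsectionP. Qed.

Lemma bounded_sub A B : A `<=` B -> bounded EE B -> bounded EE A.
Proof.
by move=> AB [E [x [? BE]]]; exists E, x; split=> //; exact: subset_trans AB BE.
Qed.

Lemma bounded1 x : bounded EE [set x].
Proof.
have [E EE_E Exx] := coarse_entourage x x.
by apply: (bounded_intro (x := x) EE_E) => y ->.
Qed.

Lemma boundedU A B : bounded EE A -> bounded EE B -> bounded EE (A `|` B).
Proof.
move=> bA; have [_ [x _]] := bA => /(bounded_from x)[F EE_F BF].
have [E EE_E AE] := bounded_from x bA.
have [G [EE_G EG FG]] := coarse_join EE_E EE_F.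
by apply: (bounded_intro (x := x) EE_G) => y [/AE/EG|/BF/FG].
Qed.

Lemma bounded_setball E B : EE E -> bounded EE B -> bounded EE (setball E B).
Proof.
move=> EE_E [F [x [EE_F BF]]].
apply: (bounded_intro (x := x) (coarse_comp HE EE_F EE_E)).
by move=> y [b /BF/xsectionP ? /xsectionP ?]; exists b.
Qed.

Lemma bounded_square B : bounded EE B -> EE (diagonal `|` B `*` B).
Proof.
move=> [E [x [EE_E BE]]].
apply: (coarse_sub HE (coarse_comp HE (coarse_inv HE EE_E) EE_E)).
  by move=> [a b]; left.
move=> [a b] [/diagonalP ->|[/= /BE/xsectionP Ea /BE/xsectionP Eb]]; last by exists x.
by exists b; exact: (coarse_refl EE_E).
Qed.

(** A singleton is bounded, so it has no unbounded subset to offer. Hence linkedness determines the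
    bounded sets. *)
Lemma bounded_linkedE B x : linked EE B [set x] <-> bounded EE B.
Proof.
split=> [[[]//|[A [C [_ Cx _ nbC _]]]]|bB].
  by case: nbC; exact: bounded_sub Cx (bounded1 x).
by left; split=> //; exact: bounded1.
Qed.

Lemma linked_image (I : Type) (S : set I) (f g : I -> X) E :
  EE E -> (forall s, S s -> E (f s, g s)) ->
  ~ bounded EE (f @` S) -> linked EE (f @` S) (g @` S).
Proof.
move=> EE_E fgE nb; right; exists (f @` S), (g @` S).
have gE : f @` S `<=` setball (E^-1)%relation (g @` S).
  by move=> _ [s Ss <-]; exists (g s); [exists s | apply/xsectionP/fgE].
split=> //; first by move=> /(bounded_setball (coarse_inv HE EE_E))/(bounded_sub gE).
have [G [EE_G EG iG]] := coarse_join EE_E (coarse_inv HE EE_E).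
exists G; split=> // _ [s Ss <-].
  by exists (g s); [exists s | apply/xsectionP/iG/fgE].
by exists (f s); [exists s | apply/xsectionP/EG/fgE].
Qed.

End CoarseStructure.

Lemma lambda_bounded (X : Type) (EE EE' : set (set (X * X))) :
  is_coarse_structure EE -> is_coarse_structure EE' -> lambda_equivalent EE EE' ->
  forall B, bounded EE B <-> bounded EE' B.
Proof.
move=> HE HE' eqE B; split=> bB; have [_ [x _]] := bB.
  by apply/(bounded_linkedE HE' _ x); rewrite -eqE; apply/bounded_linkedE.
by apply/(bounded_linkedE HE _ x); rewrite eqE; apply/bounded_linkedE.
Qed.

(** * Sparse families selected along a linear base *)

Section Selection.
Variables (X : Type) (EE BB : set (set (X * X))).
Hypotheses (HE : is_coarse_structure EE) (bBB : is_base EE BB).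
Hypothesis totBB : total_on BB subset.
Variables (T : Type) (loc : T -> set X) (good : set (X * X) -> T -> Prop) (x0 : X).
Hypothesis loc_bounded : forall t, bounded EE (loc t).
Hypothesis good_far : forall F D, BB F -> bounded EE D ->
  exists2 t, good F t & forall u, loc t u -> ~ D u.

Lemma base_join E F : EE E -> EE F -> exists G, [/\ BB G, E `<=` G & F `<=` G].
Proof.
move=> EE_E EE_F; have [G [EE_G EG FG]] := coarse_join HE EE_E EE_F.
have [G' BG' GG'] := bBB.2 G EE_G.
by exists G'; split=> //; apply: subset_trans GG'.
Qed.

Let sparse (S : set (set (X * X) * T)) :=
  (forall s, S s -> [/\ BB s.1, good s.1 s.2 &
     forall u, loc s.2 u -> ~ (s.1 \; s.1)%relation (x0, u)]) /\
  (forall s t, S s -> S t -> s <> t -> t.1 `<=` s.1 ->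
     forall u, loc t.2 u -> s.1 (x0, u)).

(** Tags that do not contain [G] lie below a base entourage [G']. Of two such pairs, the one with
    the smaller tag lies in [G'[x0]]; so at most one pair leaves [G'[x0]], and its [loc] is
    bounded. *)
Let sparse_tail S G : sparse S -> EE G ->
  bounded EE [set u | exists2 t, S t & loc t.2 u /\ ~ G `<=` t.1].
Proof.
move=> [S1 S2] EE_G; have [G' BG' GG'] := bBB.2 G EE_G.
have EE_G' := bBB.1 G' BG'.
suff [C bC CP] : exists2 C, bounded EE C & forall t, S t -> ~ G `<=` t.1 ->
    (loc t.2 `<=` C).
  by apply: bounded_sub bC => u [t St [lu /CP]]; apply.
have bG' : bounded EE (xsection G' x0) by exists G', x0; split.
have below t : S t -> ~ G `<=` t.1 -> t.1 `<=` G'.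
  move=> St nG; have [B1 _ _] := S1 _ St.
  by have [//|G't] := totBB B1 BG'; case: nG; exact: subset_trans GG' G't.
have [[s [Ss ns nl]]|nex] := pselect (exists s, [/\ S s, ~ G `<=` s.1 &
    ~ loc s.2 `<=` xsection G' x0]).
  exists (xsection G' x0 `|` loc s.2); first exact: boundedU.
  move=> t St nt; have [<-|tNs] := pselect (t = s); first by right.
  left; apply/xsectionP.
  have [B1 _ _] := S1 _ Ss; have [B2 _ _] := S1 _ St.
  have [ts|st] := totBB B2 B1.
    by apply: (below _ Ss) => //; apply: (S2 _ _ Ss St) => //; exact: nesym.
  case: nl => v lv; apply/xsectionP/(below _ St nt).
  exact: (S2 _ _ St Ss).
exists (xsection G' x0) => // t St nt.
by apply: contrapT => nl; apply: nex; exists t.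
Qed.

(* The selected pairs (E, t) are kept apart by tagging each t with an entourage
   E such that everything with a smaller tag lies in E[x0], while t lies outside
   (E o E)[x0].  By maximality (Zorn) the tags are cofinal: this replaces a
   transfinite recursion along a cofinal well-ordered subfamily of the base. *)
Lemma cofinal_selection : exists S : set (set (X * X) * T),
  [/\ forall s, S s -> EE s.1 /\ good s.1 s.2,
      forall s t, S s -> S t -> s <> t -> forall u v, loc s.2 u -> loc t.2 v ->
        ~ (s.1 (u, v) /\ s.1 (v, u)),
      forall G, EE G ->
        bounded EE [set u | exists2 t, S t & loc t.2 u /\ ~ G `<=` t.1] &
      forall f, (forall t, loc t (f t)) -> ~ bounded EE [set f s.2 | s in S]].
Proof.
have [|S [spS maxS]] := @Zorn_bigcup _ sparse.
  move=> F Fsp Ftot; split=> [s [A FA As]|s t [A FA As] [B FB Bt]].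
    exact: (Fsp _ FA).1.
  have [AB|BA] := Ftot _ _ FA FB; first by apply: (Fsp _ FB).2 => //; exact: AB.
  by apply: (Fsp _ FA).2 => //; exact: BA.
have [S1 S2] := spS.
exists S; split.
- by move=> s /S1[/bBB.1].
- move=> s t Ss St st u v su tv [uv vu].
  have [Bs _ fs] := S1 _ Ss; have [Bt _ ft] := S1 _ St.
  (* With [E] the larger of the two tags, the pair with the smaller tag lies in [E[x0]], so a step
     of [s.1] towards the other pair would put that one inside (E o E)[x0]. *)
  have [ts|le_st] := totBB Bt Bs.
    by apply: fs su _; exists v => //=; exact: (S2 _ _ Ss St).
  apply: ft tv _; exists u => /=; last exact: le_st.
  by apply: (S2 _ _ St Ss) => //; exact: nesym.
- by move=> G; exact: sparse_tail.
move=> f locf /(bounded_from HE x0)[G EE_G fG].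
(* A tag containing [G] would capture its own point, so no tag does. All of [S] is then a bounded
   tail, and a pair tagged beyond [G] and [H] extends it, against maximality. *)
have [[s [Ss Gs]]|nex] := pselect (exists s, S s /\ G `<=` s.1).
  have [/bBB.1 Es _ far] := S1 _ Ss; apply: far (locf s.2) _.
  exists (f s.2); last exact: (coarse_refl HE Es).
  by apply/Gs/fG; exists s.
have notin s : S s -> ~ G `<=` s.1 by move=> Ss Gs; apply: nex; exists s; split.
have [H EE_H CH] := bounded_from HE x0 (sparse_tail spS EE_G).
have [F [BF GF HF]] := base_join EE_G EE_H.
have EE_F := bBB.1 F BF.
have bD : bounded EE (xsection (F \; F)%relation x0).
  by exists (F \; F)%relation, x0; split=> //; exact: (coarse_comp HE).
have [t gt tD] := good_far BF bD.
have inF s : S s -> forall u, loc s.2 u -> F (x0, u).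
  by move=> Ss u su; apply/HF/CH; exists s => //; split=> //; exact: notin.
apply: (maxS (S `|` [set (F, t)])).
  split; first by apply: subsetUl.
  move=> /(_ (F, t)) St; have /notin : S (F, t) by apply: St; right.
  by apply.
split.
  move=> s [/S1//|->]; split=> //= u tu Fu; apply: tD tu _.
  exact/xsectionP.
move=> s r [Ss|->] [Sr|->]; first exact: S2.
- by move=> _ /= Fs; case: (notin _ Ss); exact: subset_trans GF Fs.
- by move=> _ _; exact: inF.
- by [].
Qed.

End Selection.

(** * Strength of ordinal balleans and rigidity of the discrete ones *)

Lemma ordinal_strong (X : Type) (EE : set (set (X * X))) :
  is_coarse_structure EE -> ordinal_ballean EE -> lambda_strong EE.
Proof.
move=> HE [BB bBB totBB] EE' HE' eqE E' EE_E'.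
(* On an empty carrier nothing is bounded, so [set0] being linked to itself only says that some
   entourage exists; and there is only one relation. *)
have [[x0 _]|Xempty] := pselect (exists x0 : X, True); last first.
  have nb FF : ~ bounded FF (@set0 X) by move=> [_ [x _]]; apply: Xempty; exists x.
  have : linked EE' (@set0 X) set0.
    by right; exists set0, set0; split=> //; exists E'; split.
  rewrite eqE => -[[/nb//]|[_ [_ [_ _ _ _ [E [EE_E _ _]]]]]].
  suff -> : E' = E by [].
  by apply/seteqP; split=> -[x]; case: Xempty; exists x.
have bE := lambda_bounded HE' HE eqE.
apply: contrapT => nEE_E'.
have esc M : EE M -> exists2 p, E' p & ~ M p.
  move=> EE_M; apply: contrapT => nesc; apply: nEE_E'.
  apply: (coarse_sub HE EE_M); first exact: (coarse_diag HE').
  by move=> p E'p; apply: contrapT => nMp; apply: nesc; exists p.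
pose loc (p : X * X) := [set p.1; p.2].
pose good (F : set (X * X)) p := E' p /\ ~ F p.
have loc_bounded p : bounded EE (loc p) by apply: boundedU => //; exact: bounded1.
have good_far F D : BB F -> bounded EE D ->
    exists2 p, good F p & forall u, loc p u -> ~ D u.
  move=> /bBB.1 EE_F bD.
  (* A pair of [E'] with one end in [D] has both ends in [D']. A pair outside the square of [D']
     therefore avoids [D]. *)
  pose D' := D `|` (setball E' D `|` setball (E'^-1)%relation D).
  have bD' : bounded EE D'.
    apply/bE; apply: boundedU => //; first exact/bE.
    by apply: boundedU => //; apply: bounded_setball => //;
      [exact/bE | exact: (coarse_inv HE') | exact/bE].
  have [M [EE_M FM DM]] := coarse_join HE EE_F (bounded_square HE bD').
  have [[x y] E'xy nMxy] := esc M EE_M; exists (x, y).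
    by split=> // /FM.
  move=> u [] /= -> Du; apply/nMxy/DM; right; split=> /=.
  - by left.
  - by right; left; exists x => //; exact/xsectionP.
  - by right; right; exists y => //; exact/xsectionP.
  - by left.
have [S [Sgood Ssep Stail Sunb]] :=
  cofinal_selection HE bBB totBB x0 loc_bounded good_far.
have : linked EE' [set s.2.1 | s in S] [set s.2.2 | s in S].
  apply: (linked_image HE' EE_E') => [s /Sgood[_ []]|/bE]; first by case: (s.2).
  by apply: (Sunb fst) => p; left.
rewrite eqE => -[[bA _]|[A [B [AS BS nbA nbB [E [EE_E AB _]]]]]].
  by apply: (Sunb fst) bA => p; left.
have [G [EE_G EG iG]] := coarse_join HE EE_E (coarse_inv HE EE_E).
(* Some point of [A] has a tag containing [G], since otherwise [A] lies in a bounded tail. Its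
   [E]-neighbour in [B] then contradicts goodness if it comes from the same pair, and separation if
   not. *)
have [[s [Ss Gs As]]|nex] :=
  pselect (exists s, [/\ S s, G `<=` s.1 & A s.2.1]); last first.
  apply: nbA; apply: bounded_sub (Stail _ EE_G) => a Aa.
  have [s Ss sa] := AS _ Aa; exists s => //; split; first by left.
  by move=> Gs; apply: nex; exists s; split=> //; rewrite sa.
have [b Bb /xsectionP Ebs] := AB _ As; have [t St tb] := BS _ Bb.
rewrite -tb in Ebs.
have [st|sNt] := pselect (s = t).
  rewrite -st in Ebs; case: (Sgood _ Ss) => _ [_]; apply.
  by case: (s.2) Ebs => x y Eyx; apply/Gs/iG.
apply: (Ssep s t Ss St sNt s.2.1 t.2.2); [by left | by right |].
by split; apply: Gs; [exact: iG | exact: EG].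
Qed.

(** Strength gives one inclusion. For the other, an entourage that is trivial off a bounded set lies
    in the diagonal plus a bounded square, and bounded squares depend only on the bounded sets. *)
Lemma discrete_rigid (X : Type) (EE : set (set (X * X))) :
  is_coarse_structure EE -> ordinal_ballean EE -> discrete_ballean EE ->
  lambda_rigid EE.
Proof.
move=> HE oE dE EE' HE' eqE; apply/seteqP; split.
  exact: (ordinal_strong HE oE HE' (esym eqE)).
move=> E EE_E; have [B bB EB] := dE _ EE_E.
have bD : bounded EE' (B `|` setball E B).
  apply/(lambda_bounded HE HE' eqE).
  by apply: boundedU => //; exact: bounded_setball.
apply: (coarse_sub HE' (bounded_square HE' bD)); first exact: (coarse_diag HE).
move=> [x y] Exy; have [Bx|nBx] := pselect (B x).
  by right; split; [left | right; exists x => //; exact/xsectionP].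
by left; apply/diagonalP; have /xsectionP := Exy; rewrite EB// => ->.
Qed.

(** * Unbounded families of pairs with disjoint supports *)

Definition support (X : Type) (Q : set (X * X)) : set X := fst @` Q `|` snd @` Q.

(** Couples of elements of [Q] with disjoint ends are selected; first members form [Q0], second
    members [Q1]. Distinct couples share no point, as tags are reflexive. *)
Lemma disjoint_supports (X : Type) (EE : set (set (X * X))) (x0 : X) E Q :
  is_coarse_structure EE -> ordinal_ballean EE -> EE E -> Q `<=` E ->
  ~ bounded EE (fst @` Q) ->
  exists Q0 Q1, [/\ Q0 `<=` Q, Q1 `<=` Q, ~ bounded EE (fst @` Q0),
    ~ bounded EE (fst @` Q1) & support Q0 `<=` ~` support Q1].
Proof.
move=> HE [BB bBB totBB] EE_E QE nbQ.
pose ends (p : X * X) := [set p.1; p.2].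
have bends p : bounded EE (ends p) by apply: boundedU => //; exact: bounded1.
have esc D : bounded EE D -> exists2 p, Q p & forall u, ends p u -> ~ D u.
  move=> bD; pose D' := D `|` setball (E^-1)%relation D.
  have bD' : bounded EE D'.
    by apply: boundedU => //; apply: bounded_setball => //; exact: (coarse_inv HE).
  apply: contrapT => nesc; apply: nbQ; apply: bounded_sub bD' => _ [p Qp <-].
  apply: contrapT => nD'p; apply: nesc; exists p => // u [] -> Du; apply: nD'p.
    by left.
  right; exists p.2 => //; apply/xsectionP; apply: QE.
  by case: (p) Qp.
pose loc (t : (X * X) * (X * X)) := ends t.1 `|` ends t.2.
pose good (F : set (X * X)) (t : (X * X) * (X * X)) :=
  [/\ Q t.1, Q t.2 & ends t.2 `<=` ~` ends t.1].
have loc_bounded t : bounded EE (loc t) by exact: boundedU.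
have good_far F D : BB F -> bounded EE D ->
    exists2 t, good F t & forall u, loc t u -> ~ D u.
  move=> _ bD; have [p Qp pD] := esc D bD.
  have [q Qq qD] := esc (D `|` ends p) (boundedU HE bD (bends p)).
  exists (p, q); first by split=> // u /qD + pu; apply; right.
  by move=> u [/pD//|/qD + Du]; apply; left.
have [S [Sgood Ssep _ Sunb]] :=
  cofinal_selection HE bBB totBB x0 loc_bounded good_far.
exists [set s.2.1 | s in S], [set s.2.2 | s in S]; split.
- by move=> _ [s /Sgood[_ []] ? ? ? <-].
- by move=> _ [s /Sgood[_ []] ? ? ? <-].
- rewrite image_comp; apply: (Sunb (fun t => t.1.1)) => t.
  by left; left.
- rewrite image_comp; apply: (Sunb (fun t => t.2.1)) => t.
  by right; left.
have suppE (f : (X * X) * (X * X) -> X * X) u :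
    support [set f s.2 | s in S] u -> exists2 s, S s & ends (f s.2) u.
  by case=> -[_ [s Ss <-] <-]; exists s => //; [left|right].
move=> u /(suppE fst)[s Ss su] /(suppE snd)[t St tu].
have [st|sNt] := pselect (s = t).
  by have [_ [_ _]] := Sgood _ Ss; apply; first by rewrite st; exact: tu.
have [EE_s _] := Sgood _ Ss.
apply: (Ssep s t Ss St sNt u u); first by left.
  by right.
by split; exact: (coarse_refl HE EE_s).
Qed.

(** * Thinning a coarse structure along a filter *)

Section Thinning.
Variables (X : Type) (EE : set (set (X * X))) (phi : set_system X).
Hypotheses (HE : is_coarse_structure EE) (phiF : Filter phi).
Hypothesis phi_bounded : forall B, bounded EE B -> phi (~` B).

(** Triviality is asked at either end of a pair, which makes the condition stable under inverse and
    composition. *)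
Definition thinning : set (set (X * X)) :=
  [set E | EE E /\
    exists2 U, phi U & forall x y, E (x, y) -> U x \/ U y -> x = y].

Lemma thinning_square B : bounded EE B -> thinning (diagonal `|` B `*` B).
Proof.
move=> bB; split; first exact: bounded_square.
exists (~` B); first exact: phi_bounded.
by move=> x y [/diagonalP//|[/= Bx By] []].
Qed.

Lemma thinning_coarse : is_coarse_structure thinning.
Proof.
split.
- by move=> E [EE_E _]; exact: (coarse_diag HE).
- move=> E F [EE_E [U phiU EU]] [EE_F [V phiV FV]].
  split; first exact: (coarse_comp HE).
  exists (U `&` V); first exact: filterI.
  move=> x y [z /= Exz Fzy] [[Ux Vx]|[Uy Vy]].
    have xz : x = z by apply: EU => //; left.
    by rewrite xz; apply: FV => //; left; rewrite -xz.
  have zy : z = y by apply: FV => //; right.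
  by rewrite -zy; apply: EU => //; right; rewrite zy.
- move=> E [EE_E [U phiU EU]]; split; first exact: (coarse_inv HE).
  by exists U => // x y /EU yx Uxy; apply/esym/yx; case: Uxy; [right|left].
- move=> E F [EE_E [U phiU EU]] dF FE; split; first exact: (coarse_sub HE EE_E).
  by exists U => // x y /FE; exact: EU.
- apply/seteqP; split=> // -[x y] _.
  exists (diagonal `|` [set x; y] `*` [set x; y]).
    by apply/thinning_square/boundedU => //; exact: bounded1.
  by right; split; [left|right].
Qed.

Lemma thinning_boundedE B : bounded thinning B <-> bounded EE B.
Proof.
split=> [[E [x [[EE_E _] BE]]]|bB]; first by exists E, x.
have [_ [x _]] := bB.
have sq := thinning_square (boundedU HE bB (bounded1 HE x)).
apply: (bounded_intro (x := x) sq) => y By.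
by right; split; [right|left].
Qed.

End Thinning.

Lemma linked_mono (X : Type) (EE EE' : set (set (X * X))) (A B A' B' : set X) :
  EE `<=` EE' -> (forall C, bounded EE C <-> bounded EE' C) ->
  A `<=` A' -> B `<=` B' -> ~ bounded EE A -> linked EE A B -> linked EE' A' B'.
Proof.
move=> EEs bE AA' BB' nbA [[//]|[C [D [CA DB nbC nbD [E [EE_E CE DE]]]]]].
right; exists C, D; split.
- exact: subset_trans AA'.
- exact: subset_trans BB'.
- by move=> /bE.
- by move=> /bE.
- by exists E; split=> //; exact: EEs.
Qed.

Lemma ultra_thinning_equivalent (X : Type) (EE : set (set (X * X)))
    (phi : set_system X) :
  is_coarse_structure EE -> ordinal_ballean EE -> UltraFilter phi ->
  (forall B, bounded EE B -> phi (~` B)) ->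
  lambda_equivalent EE (thinning EE phi).
Proof.
move=> HE oE phiU phib.
have HT : is_coarse_structure (thinning EE phi) by exact: thinning_coarse.
have bT := thinning_boundedE HE phib.
apply/funext => A; apply/funext => B; apply/propext; split; last first.
  case=> [[/bT bA /bT bB]|[C [D [CA DB nbC nbD cl]]]]; first by left.
  apply: (linked_mono _ bT CA DB nbC); first by move=> E [].
  by right; exists C, D; split.
case=> [[/bT bA /bT bB]|[C [D [CA DB nbC nbD [E [EE_E CE DE]]]]]]; first by left.
pose Q := [set p | [/\ C p.1, D p.2 & E (p.2, p.1)]].
have QC : fst @` Q = C.
  apply/seteqP; split=> [_ [p [Cp _ _] <-]//|c Cc].
  by have [d Dd /xsectionP Edc] := CE _ Cc; exists (c, d).
have [x0 _] := filter_ex (filterT : phi setT).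
have QE : Q `<=` (E^-1)%relation by move=> p [].
have nbQ : ~ bounded EE (fst @` Q) by rewrite QC.
have [Q0 [Q1 [Q0Q Q1Q nb0 nb1 Q01]]] :=
  disjoint_supports x0 HE oE (coarse_inv HE EE_E) QE nbQ.
have [P [PQ nbP phiP]] :
    exists P, [/\ P `<=` Q, ~ bounded EE (fst @` P) & phi (~` support P)].
  (* If [phi] contains the support of [Q1], it contains the complement of that of [Q0]. *)
  have [phi1|phi1] := in_ultra_setVsetC (support Q1) phiU; last by exists Q1.
  by exists Q0; split=> //; apply: filterS phi1 => u + /Q01.
have TP : thinning EE phi
    (diagonal `|` ((E^-1)%relation `&` support P `*` support P)).
  split.
    apply: (coarse_sub HE (coarse_inv HE EE_E)); first by move=> p; left.
    by move=> p [/(coarse_diag HE (coarse_inv HE EE_E))|[]].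
  by exists (~` support P) => // x y [/diagonalP//|[_ [/= Px Py]] []].
have nbPT : ~ bounded (thinning EE phi) (fst @` P) by move=> /bT.
apply: (linked_mono (EE := thinning EE phi) (A := fst @` P) (B := snd @` P)) => //.
- by move=> _ [p /PQ[/CA ? _ _] <-].
- by move=> _ [p /PQ[_ /DB ? _] <-].
apply: (linked_image HT TP) => // p Pp; right; split.
  by have [_ _] := PQ _ Pp.
by split; [left; exists p | right; exists p].
Qed.

(** A point is required: on an empty carrier the structure whose only entourage is empty is rigid,
    yet it has no bounded set and is not discrete. *)
Lemma rigid_discrete (X : Type) (EE : set (set (X * X))) :
  [set: X] !=set0 -> is_coarse_structure EE -> ordinal_ballean EE ->
  lambda_rigid EE -> discrete_ballean EE.
Proof.
move=> [x0 _] HE oE rE E EE_E; apply: contrapT => nd.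
pose moved := [set x | xsection E x <> [set x]].
(* No bounded [B] witnesses discreteness for [E], so no set [moved] minus [B] is empty. *)
have [phi [phiU subphi]] : exists phi, UltraFilter phi /\
    filter_from (bounded EE) (fun B => moved `\` B) `<=` phi.
  apply: ultraFilterLemma; apply: filter_from_proper.
    apply: filter_from_filter; first by exists [set x0]; exact: (bounded1 HE).
    move=> B C bB bC; exists (B `|` C); first exact: boundedU.
    by move=> x [mx nx]; split; split=> // ?; apply: nx; [left|right].
  move=> B bB; apply: contrapT => n0; apply: nd; exists B => // x nBx.
  by apply: contrapT => mx; apply: n0; exists x.
have phib B : bounded EE B -> phi (~` B).
  by move=> bB; apply: subphi; exists B => // x [].
have : thinning EE phi E.
  rewrite (rE _ _ (ultra_thinning_equivalent HE oE phiU phib))//.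
  exact: thinning_coarse.
move=> [_ [U phiU' EU]].
have phim : phi moved.
  by apply: subphi; exists [set x0]; [exact: (bounded1 HE) | move=> x []].
have [x [Ux]] := filter_ex (filterI phiU' phim); apply.
apply/seteqP; split=> [y /xsectionP Exy|_ ->].
  by apply/esym/(EU _ _ Exy); left.
by apply/xsectionP; exact: (coarse_refl HE EE_E).
Qed.

(** * Metric coarse structures and the real line *)

Section Metric.
Variables (R : realType).
Import Order.TTheory GRing.Theory Num.Theory.
Local Open Scope ring_scope.

Definition metric_coarse (X : Type) (d : X -> X -> R) : set (set (X * X)) :=
  [set E | diagonal `<=` E /\
    exists2 r, 0 < r & forall x y, E (x, y) -> d x y < r].

Lemma metric_base (X : Type) (d : X -> X -> R) : is_metric d ->
  is_base (metric_coarse d) [set [set xy | d xy.1 xy.2 < r] | r in [set r | 0 < r]].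
Proof.
move=> dm; split=> [_ [r /= r0 <-]|E [_ [r r0 Er]]].
  split; last by exists r.
  by move=> [x y] /diagonalP -> /=; rewrite (metric_eq0 dm y y).2.
exists [set xy | d xy.1 xy.2 < r]; first by exists r.
by move=> [x y] /Er.
Qed.

Lemma metric_coarse_structure (X : Type) (d : X -> X -> R) :
  is_metric d -> is_coarse_structure (metric_coarse d).
Proof.
move=> dm; split.
- by move=> E [].
- move=> E F [dE [r r0 Er]] [dF [s s0 Fs]]; split.
    by move=> [x y] /diagonalP ->; exists y; [exact: dE | exact: dF].
  exists (r + s) => [|x y [z /Er xz /Fs zy]]; first exact: addr_gt0.
  by apply: le_lt_trans (metric_triangle dm x z y) _; exact: ltrD.
- move=> E [dE [r r0 Er]]; split; first by move=> [x y] /diagonalP ->; exact: dE.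
  by exists r => // x y /Er; rewrite (metric_sym dm).
- by move=> E F [_ [r r0 Er]] dF FE; split=> //; exists r => // x y /FE /Er.
- apply/seteqP; split=> // -[x y] _.
  have r0 : 0 < d x y + 1 by rewrite ltr_wpDl// (metric_ge0 dm).
  exists [set xy | d xy.1 xy.2 < d x y + 1]; last by rewrite /= ltrDl.
  by apply: (metric_base dm).1; exists (d x y + 1).
Qed.

Lemma metrizable_ordinal (X : Type) (EE : set (set (X * X))) :
  metrizable_ballean R EE -> ordinal_ballean EE.
Proof.
move=> [d dm bd]; eexists; first exact: bd.
move=> _ _ [r _ <-] [s _ <-]; have [rs|/ltW sr] := leP r s; [left|right] => p /= dp.
  exact: lt_le_trans dp rs.
exact: lt_le_trans dp sr.
Qed.

Let dist (x y : R) := `|x - y|.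

Let dist_metric : is_metric dist.
Proof.
split=> [x y|x y|x y|x y z]; rewrite /dist.
- exact: normr_ge0.
- by split=> [/normr0_eq0/subr0_eq|->]; rewrite ?subrr ?normr0.
- exact: distrC.
- exact: ler_distD.
Qed.

(** A set within distance less than [r] of [x] misses [x + r], which the entourage of radius 2 still
    moves to [x + r + 1]. *)
Lemma real_line_not_discrete : ~ discrete_ballean (metric_coarse dist).
Proof.
move=> /(_ [set xy | dist xy.1 xy.2 < 2]) [|B [E [x [[_ [r r0 Er]] BE]]] Bd].
  by apply: (metric_base dist_metric).1; exists 2 => //=; rewrite ltr0n.
have nB : ~ B (x + r).
  move=> /BE/xsectionP/Er; rewrite /dist opprD addNKr normrN gtr0_norm//.
  by rewrite ltxx.
have : xsection [set xy | dist xy.1 xy.2 < 2] (x + r) (x + r + 1).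
  by apply/xsectionP; rewrite /= /dist opprD addNKr normrN normr1 ltr1n.
rewrite Bd// => /(congr1 (fun z => z - (x + r))).
by rewrite addrAC subrr add0r; apply/eqP; exact: oner_neq0.
Qed.

Lemma real_line_not_rigid : exists EE', [/\ is_coarse_structure EE',
  lambda_equivalent (metric_coarse dist) EE' & EE' <> metric_coarse dist].
Proof.
have Hd := metric_coarse_structure dist_metric.
have od : ordinal_ballean (metric_coarse dist).
  by apply: metrizable_ordinal; exists dist => //; exact: metric_base.
apply: contrapT => nEE'; apply: real_line_not_discrete.
apply: rigid_discrete => //; first by exists 0.
move=> EE' HE' eqE; apply: contrapT => ne; apply: nEE'.
by exists EE'.
Qed.

(** Stability would put a second structure equivalent to the real line into [K], and rigidity of [K]
    would identify the two. *)
Lemma not_stable (K : ballean_class) :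
  (forall X (EE : set (set (X * X))), metrizable_ballean R EE -> K X EE) ->
  lambda_rigid_class K -> ~ lambda_stable_class K.
Proof.
move=> MK rK sK; have [EE' [HE' eqE ne]] := real_line_not_rigid.
have Hd := metric_coarse_structure dist_metric.
have Kd : K R (metric_coarse dist).
  by apply: MK; exists dist => //; exact: metric_base.
by apply/ne/esym/(rK R) => //; exact: (sK R _ _ Hd HE' eqE).
Qed.

End Metric.

(** * Rigidity of the classes and conclusion *)

Lemma ordinal_rigid_class : lambda_rigid_class (@ordinal_ballean).
Proof.
move=> X EE EE' HE HE' eqE oE oE'; apply/seteqP; split.
  exact: (ordinal_strong HE' oE' HE eqE).
exact: (ordinal_strong HE oE HE' (esym eqE)).
Qed.

Theorem theorem6 (R : realType) :
  (forall (X : Type) (EE : set (set (X * X))),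
     is_coarse_structure EE -> ordinal_ballean EE -> lambda_strong EE) /\
  (lambda_rigid_class (@metrizable_ballean R) /\
   lambda_rigid_class (@ordinal_ballean)) /\
  (forall (X : Type) (EE : set (set (X * X))),
     [set: X] !=set0 ->
     is_coarse_structure EE -> ordinal_ballean EE ->
     (lambda_rigid EE <-> discrete_ballean EE)) /\
  (~ lambda_stable_class (@metrizable_ballean R) /\
   ~ lambda_stable_class (@ordinal_ballean)).
Proof.
have rM : lambda_rigid_class (@metrizable_ballean R).
  move=> X EE EE' HE HE' eqE /metrizable_ordinal oE /metrizable_ordinal oE'.
  exact: ordinal_rigid_class.
split; first exact: ordinal_strong.
split; first by split=> //; exact: ordinal_rigid_class.
split.
  move=> X EE X0 HE oE; split; first exact: rigid_discrete.
  exact: discrete_rigid.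
split; first exact: (not_stable (fun _ _ => id) rM).
apply: (@not_stable R); last exact: ordinal_rigid_class.
by move=> X EE; exact: metrizable_ordinal.
Qed.
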